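(* Let $G=G_n(g,f)$ be a Riordan graph with vertex set $V=[n]$ and edge set $E$. Then one of the following holds: (i) $i(i+1)\notin E$ for all $1\le i\le n-1$; (ii) $12\in E$ and $i(i+1)\notin E$ for all $2\le i\le n-1$; (iii) $i(i+1)\in E$ for all $1\le i\le n-1$, i.e. $G$ has the Hamiltonian path $1\to 2\to\cdots\to n$.
   Context: Write $a\equiv b$ for congruence modulo $2$ and $[t^k]h$ for the coefficient of $t^k$ in a formal power series $h$. For $g,f\in\mathbb{Z}[[t]]$ (or $\mathbb{Z}_2[[t]]$) with $f(0)=0$ and $n\ge 1$, the Riordan graph $G_n(g,f)$ is the simple graph with vertex set $[n]=\{1,\dots,n\}$ in which, for $i>j\ge 1$, the vertices $i$ and $j$ are adjacent if and only if $[t^{i-2}]\,g f^{\,j-1}\equiv 1$ (with $f^0=1$). Here $ij$ denotes the edge joining $i$ and $j$. *)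

(* Defs.v *)
From mathcomp Require Import all_boot all_order all_algebra.

Set Implicit Arguments.
Unset Strict Implicit.
Unset Printing Implicit Defensive.

Import GRing.Theory.
Local Open Scope ring_scope.

(* h : fps R is the formal power series whose coefficient [t^k]h is h k. *)
Definition fps (R : comNzRingType) := nat -> R.

Definition fps1 (R : comNzRingType) : fps R := fun k => (k == 0%N)%:R.

Definition fps_mul (R : comNzRingType) (g h : fps R) : fps R :=
  fun k => \sum_(i < k.+1) g i * h (k - i)%N.

Definition fps_exp (R : comNzRingType) (f : fps R) (m : nat) : fps R :=
  iter m (fps_mul f) (fps1 R).

Record sgraph (T : finType) := SGraph {
  adj :> rel T;
  adj_sym : symmetric adj;
  adj_irr : irreflexive adj
}.

Definition hamiltonian_path (T : finType) (G : sgraph T) (s : seq T) : bool :=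
  [&& uniq s, [forall x, x \in s] & sorted G s].

Definition eqmod2_int : rel int := fun a b => (a == b %[mod 2])%Z.
Definition eqmod2_F2 : rel 'F_2 := fun a b => a == b.

Section Riordan.
Variables (R : comNzRingType) (eqmod2 : rel R) (n : nat) (g f : fps R).

(* The condition [t^{i-2}] g f^{j-1} = 1 (mod 2), meant for i > j >= 1, so that
   neither truncated subtraction below underflows. *)
Definition riordan_entry (i j : nat) : bool :=
  eqmod2 (fps_mul g (fps_exp f (j - 1)%N) (i - 2)%N) 1.

(* The ordinal u : 'I_n stands for the vertex u.+1 of [n] = {1, ..., n}. *)
Definition riordan_adj : rel 'I_n := fun u v =>
  ((v < u)%N && riordan_entry u.+1 v.+1)
  || ((u < v)%N && riordan_entry v.+1 u.+1).

Lemma riordan_adj_sym : symmetric riordan_adj.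
Proof. by move=> u v; rewrite /riordan_adj orbC. Qed.

Lemma riordan_adj_irr : irreflexive riordan_adj.
Proof. by move=> u; rewrite /riordan_adj ltnn. Qed.

Definition riordan_graph : sgraph 'I_n := SGraph riordan_adj_sym riordan_adj_irr.

End Riordan.

Definition is_riordan_graph (n : nat) (G : sgraph 'I_n) : Prop :=
  (exists g f : fps int, f 0%N = 0 /\ G = riordan_graph eqmod2_int n g f)
  \/ (exists g f : fps 'F_2, f 0%N = 0 /\ G = riordan_graph eqmod2_F2 n g f).

(* i and j are 1-based labels; false when one of them lies outside {1, ..., n}. *)
Definition edge (n : nat) (G : sgraph 'I_n) (i j : nat) : bool :=
  [exists u : 'I_n, exists v : 'I_n, [&& u.+1 == i, v.+1 == j & G u v]].

(* Main.v *)
Require Import Defs.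
From mathcomp Require Import all_boot all_order all_algebra.

(** The vertices [i] and [i + 1] are joined according to the coefficient of
    [t ^ (i - 1)] in [g f ^ (i - 1)].  Since [f] has no constant term,
    [f ^ (i - 1)] is divisible by [t ^ (i - 1)], with quotient of constant term
    [f_1 ^ (i - 1)], so this coefficient is the single product [g_0 f_1 ^ (i - 1)] (lemma
    [coef_mul_exp_diag]).  Being congruent to [1] modulo [2] is multiplicative,
    so [i] and [i + 1] are adjacent exactly when [g_0] is odd and either
    [i = 1] or [f_1] is odd (lemma [edge_succ]).  The three outcomes are then:
    [g_0] even; [g_0] odd and [f_1] even; both odd.  For [n = 1] there is
    nothing to join, and the first outcome holds vacuously. *)

Set Implicit Arguments.
Unset Strict Implicit.
Unset Printing Implicit Defensive.

Import GRing.Theory.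

Section PowerSeries.
Local Open Scope ring_scope.
Variables (R : comNzRingType) (f : fps R).
Hypothesis f0 : f 0%N = 0.

(** Each of the [m] factors is divisible by [t]. *)
Lemma coef_exp_lt m k : (k < m)%N -> fps_exp f m k = 0.
Proof.
elim: m k => [//|m IHm] k ltkm.
rewrite /fps_exp iterS -/(fps_exp f m) /fps_mul.
apply: big1 => -[[|i] lti] _ /=; first by rewrite f0 mul0r.
rewrite IHm ?mulr0 //.
by case: k ltkm lti => // k ltkm lti; rewrite subSS (leq_ltn_trans (leq_subr i k)).
Qed.

Lemma coef_exp_diag m : fps_exp f m m = f 1%N ^+ m.
Proof.
elim: m => [|m IHm]; first by rewrite expr0.
rewrite /fps_exp iterS -/(fps_exp f m) /fps_mul.
(* The term [i = 0] vanishes with [f_0], those with [i > 1] by the order bound. *)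
rewrite big_ord_recl f0 mul0r add0r big_ord_recl /= subSS subn0 IHm -exprS.
rewrite big1 ?addr0 // => i _; rewrite /bump /= !add1n subSS.
rewrite coef_exp_lt ?mulr0 //.
by case: m {IHm} i => [[]//|m] i; rewrite subSS ltnS leq_subr.
Qed.

Lemma coef_mul_exp_diag (g : fps R) m :
  fps_mul g (fps_exp f m) m = g 0%N * f 1%N ^+ m.
Proof.
rewrite /fps_mul big_ord_recl subn0 coef_exp_diag big1 ?addr0 // => i _.
rewrite coef_exp_lt ?mulr0 //=.
by case: m i => [[]//|m] i; rewrite /bump add1n subSS ltnS leq_subr.
Qed.

End PowerSeries.

Section ConsecutiveVertices.
Variables (R : comNzRingType) (eqmod2 : rel R) (n : nat) (g f : fps R).

(** These two properties of congruence modulo 2 hold over the integers and over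
    the two-element field, so both kinds of coefficients are treated at once. *)
Hypothesis eqmod2_11 : eqmod2 1%R 1%R.
Hypothesis eqmod2_mul1 :
  forall x y, eqmod2 (x * y)%R 1%R = eqmod2 x 1%R && eqmod2 y 1%R.
Hypothesis f0 : f 0%N = 0%R.

Let G := riordan_graph eqmod2 n g f.

Lemma eqmod2_exp1 x m :
  eqmod2 (x ^+ m)%R 1%R = (m == 0%N) || eqmod2 x 1%R.
Proof.
elim: m => [|m IHm]; first by rewrite expr0 eqmod2_11.
by rewrite exprS eqmod2_mul1 IHm; case: eqmod2; rewrite ?orbT.
Qed.

Lemma adj_succ (u v : 'I_n) : v = u.+1 :> nat ->
  G u v = eqmod2 (g 0%N) 1%R && ((u == 0 :> nat) || eqmod2 (f 1%N) 1%R).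
Proof.
move=> vS; rewrite /= /riordan_adj vS ltnS leqnn ltnNge leqnSn /=.
rewrite /riordan_entry !subSS !subn0.
by rewrite coef_mul_exp_diag // eqmod2_mul1 eqmod2_exp1.
Qed.

Lemma edge_succ i : 1 <= i <= n - 1 ->
  edge G i (i + 1) =
  eqmod2 (g 0%N) 1%R && ((i == 1) || eqmod2 (f 1%N) 1%R).
Proof.
case: i => // i /andP[_ lein]; rewrite addn1.
have ltin : i.+1 < n by rewrite -[i.+1]add1n -ltn_subRL.
rewrite eqSS; apply/existsP/idP => [[u /existsP[v /and3P[/eqP[uE] /eqP[vE]]]]|iG].
  by rewrite adj_succ ?uE.
exists (Ordinal (ltnW ltin)); apply/existsP; exists (Ordinal ltin).
by rewrite !eqxx adj_succ.
Qed.

Lemma hamiltonian_enum :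
  eqmod2 (g 0%N) 1%R -> eqmod2 (f 1%N) 1%R -> hamiltonian_path G (enum 'I_n).
Proof.
move=> g1 f1; rewrite /hamiltonian_path enum_uniq; apply/andP; split=> //.
apply/andP; split; first by apply/forallP => x; rewrite mem_enum.
case En: (enum 'I_n) => [//|x0 s]; rewrite -En.
apply/(sortedP x0) => i; rewrite size_enum_ord => ltin.
by rewrite adj_succ ?g1 ?f1 ?orbT // !nth_enum_ord // ltnW.
Qed.

Lemma consecutive_trichotomy :
  (forall i : nat, 1 <= i <= n - 1 -> ~~ edge G i (i + 1))
  \/ (edge G 1 2 /\ forall i : nat, 2 <= i <= n - 1 -> ~~ edge G i (i + 1))
  \/ ((forall i : nat, 1 <= i <= n - 1 -> edge G i (i + 1))
      /\ hamiltonian_path G (enum 'I_n)).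
Proof.
case g1: (eqmod2 (g 0%N) 1%R); last by left=> i lti; rewrite edge_succ // g1.
case f1: (eqmod2 (f 1%N) 1%R).
  right; right; split; last exact: hamiltonian_enum.
  by move=> i lti; rewrite edge_succ // g1 f1 orbT.
(* [g_0] is odd and [f_1] is even: 1 and 2 are joined as soon as the vertex 2 exists. *)
have [n_gt1|n_le1] := ltnP 1 n.
  right; left; split; first by rewrite (@edge_succ 1) ?g1 // ltn_subRL.
  move=> i /andP[i_gt1 lti].
  by rewrite edge_succ ?(ltnW i_gt1) // g1 f1 orbF; case: i i_gt1 {lti} => [|[]].
left=> i /andP[i_gt0]; move: n_le1; rewrite -subn_eq0 => /eqP->.
by rewrite leqNgt i_gt0.
Qed.

End ConsecutiveVertices.

Lemma eqmod2_int_mul1 (x y : int) :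
  eqmod2_int (x * y)%R 1%R = eqmod2_int x 1%R && eqmod2_int y 1%R.
Proof.
rewrite /eqmod2_int -modzMm.
have mod2P (z : int) : (modz z 2 = 0 \/ modz z 2 = 1)%R.
  have := modz_ge0 z (isT : 2 != 0 :> int)%R.
  have := ltz_pmod z (isT : 0 < 2 :> int)%R.
  by case: (modz z 2) => [[|[|]]|] //; [left | right].
by case: (mod2P x) => ->; case: (mod2P y) => ->.
Qed.

Lemma eqmod2_F2_mul1 (x y : 'F_2) :
  eqmod2_F2 (x * y)%R 1%R = eqmod2_F2 x 1%R && eqmod2_F2 y 1%R.
Proof. by case: x => [[|[|]]] // ltx; case: y => [[|[|]]]. Qed.

Theorem theorem2p11 (n : nat) (hn : 1 <= n) (G : sgraph 'I_n)
  (hG : is_riordan_graph G) :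
  (* (i) *)
  (forall i : nat, 1 <= i <= n - 1 -> ~~ edge G i (i + 1))
  \/
  (* (ii) *)
  (edge G 1 2 /\ forall i : nat, 2 <= i <= n - 1 -> ~~ edge G i (i + 1))
  \/
  (* (iii); enum 'I_n is the vertex sequence 1, 2, ..., n *)
  ((forall i : nat, 1 <= i <= n - 1 -> edge G i (i + 1))
   /\ hamiltonian_path G (enum 'I_n)).
Proof.
case: hG => -[g [f [f0 ->]]]; apply: consecutive_trichotomy => //.
  exact: eqmod2_int_mul1.
exact: eqmod2_F2_mul1.
Qed.
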